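(* Let $X$ be a topological space homeomorphic to a definable set $A$ by a homeomorphism $\beta\colon X\to A$, and let $\{h_i\}_{i=1}^m$ be a finite set of functions in $HCF(X)$. Then $$\int_X\Big(\sum_{i=1}^m h_i\Big)\,d\chi=\sum_{i=1}^m\int_X h_i\,d\chi .$$
   Context: An o-minimal structure over $\mathbb{R}$ is a collection $\mathcal{A}=\{\mathcal{A}_n\}_{n\in\mathbb{N}}$, where each $\mathcal{A}_n$ is an algebra of subsets of $\mathbb{R}^n$, such that: (1) $A\in\mathcal{A}_n$, $B\in\mathcal{A}_m$ imply $A\times B\in\mathcal{A}_{n+m}$; (2) $A\in\mathcal{A}_n$ implies $\pi(A)\in\mathcal{A}_{n-1}$, where $\pi$ is the projection onto the first $n-1$ coordinates; (3) $\{x\in\mathbb{R}^n: x_i=x_j\}\in\mathcal{A}_n$ for all $1\le i<j\le n$; (4) $\{(x,y)\in\mathbb{R}^2: x<y\}\in\mathcal{A}_2$; (5) $\mathcal{A}_1$ is the collection of finite unions of points and open intervals of $\mathbb{R}$. Fix such a structure; a set $A\subset\mathbb{R}^n$ is definable if $A\in\mathcal{A}_n$, and a map between definable sets is definable if its graph is definable. An open $n$-simplex is the set $\{\sum_i t_iv_i: \sum_i t_i=1,\ t_i>0\}$ for affinely independent points $v_0,\dots,v_n\in\mathbb{R}^m$. A generalized simplicial complex is a finite collection $\mathcal{K}$ of open simplices in some $\mathbb{R}^n$ such that the closures of any two of them intersect either in the empty set or in the closure of a common face of both (the open face itself is not required to belong to $\mathcal{K}$). $|\mathcal{K}|$ denotes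 the union of its open simplices. Its Euler-Poincaré characteristic is $\chi(\mathcal{K})=\sum_i(-1)^ic_i$, where $c_i$ is the number of open $i$-simplices of $\mathcal{K}$. A triangulation of a topological space $X$ is a homeomorphism $|\mathcal{K}|\to X$; the open simplices of the triangulation are the images in $X$ of the open simplices of $\mathcal{K}$. A triangulation is compatible with a subset of $X$ if that subset is a union of open simplices of the triangulation. Standing framework: (i) (definable triangulation theorem) for every definable set $X$ and every finite family of definable subsets of $X$ there is a definable triangulation of $X$ compatible with all members of the family; the Euler-Poincaré characteristic $\chi(X)$ of a definable set is the characteristic of the generalized simplicial complex of a definable triangulation; (ii) (Beke) homeomorphic definable sets have equal characteristic, even if the homeomorphism is not definable. Let $X$ be a topological space homeomorphic to a definable set $A$ by a fixed homeomorphism $\beta\colon X\to A$; put $\chi(X):=\chi(A)$. $HCF(X)$ (homeo-integrable functions) is the $\mathbb{Z}$-module of functions $h\colon X\to\mathbb{Z}$ that are bounded, have compact support, and whose level sets are mapped by $\beta$ onto definable subsets of $A$. Every $h\in HCF(X)$ can be written as a finite sum $h=\sum_\alpha c_\alpha\mathbb{1}_{\sigma_\alpha}$ with $c_\alpha\in\mathbb{Z}$ and $\sigma_\alpha$ the open simplices of a triangulation of $X$, and the integral with respect to the Euler-Poincaré characteristic is $\int_X h\,d\chi:=\sum_\alpha c_\alpha\chi(\sigma_\alpha)$, where $\chi(\sigma)=(-1)^{\dim\sigma}$ for an open simplex; this does not depend on the chosen triangulation. *)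

(* Defs.v *)
From HB Require Import structures.
From mathcomp Require Import all_boot all_order all_algebra finmap.
From mathcomp Require Import all_classical all_reals all_analysis.
Import Order.TTheory GRing.Theory Num.Theory.
Import numFieldNormedType.Exports.

Set Implicit Arguments.
Unset Strict Implicit.
Unset Printing Implicit Defensive.

Local Open Scope classical_set_scope.
Local Open Scope ring_scope.

(* Points of R^n are row vectors; R^n x R^m is identified with R^(n + m)
   through [row_mx], and a subset [A] used as a type carries the subspace
   topology of [set_type A]. *)

(* Bounds in \bar R, so that rays and the whole line are open intervals. *)
Definition open_interval (R : realType) (I : set R) : Prop :=
  exists a b : \bar R, I = [set x | (a < x%:E)%E /\ (x%:E < b)%E].

Definition finite_union_of_points_and_intervals (R : realType) (B : set R) :
    Prop :=
  exists (N : nat) (I : 'I_N -> set R),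
    (forall i, (exists a : R, I i = [set a]) \/ open_interval (I i)) /\
    B = [set x | exists i, I i x].

Record ominimal_structure (R : realType) := OMinimal {
  definable : forall n : nat, set (set 'rV[R]_n);
  definable_set0 : forall n, definable (set0 : set 'rV[R]_n);
  definable_setU : forall n (A B : set 'rV[R]_n),
    definable A -> definable B -> definable (A `|` B);
  definable_setC : forall n (A : set 'rV[R]_n),
    definable A -> definable (~` A);
  definable_prod : forall n m (A : set 'rV[R]_n) (B : set 'rV[R]_m),
    definable A -> definable B ->
    definable [set z : 'rV[R]_(n + m) | A (lsubmx z) /\ B (rsubmx z)];
  definable_proj : forall n (A : set 'rV[R]_(n + 1)),
    definable A -> definable [set lsubmx z | z in A];
  definable_diag : forall n (i j : 'I_n), (i < j)%N ->
    definable [set x : 'rV[R]_n | x ord0 i = x ord0 j];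
  definable_lt : definable [set x : 'rV[R]_2 | x ord0 ord0 < x ord0 ord_max];
  definable_line : forall A : set 'rV[R]_1,
    definable A <->
    finite_union_of_points_and_intervals [set x ord0 ord0 | x in A]
}.

Definition definable_map (R : realType) (S : ominimal_structure R) (n m : nat)
    (A : set 'rV[R]_n) (B : set 'rV[R]_m) (f : A -> B) : Prop :=
  [/\ definable S A, definable S B &
      definable S (range (fun x : A => row_mx (set_val x) (set_val (f x))))].

Definition homeomorphism (T U : topologicalType) (f : T -> U) : Prop :=
  continuous f /\
  exists g : U -> T, [/\ continuous g, cancel f g & cancel g f].

(* An open simplex is encoded by its finite set of vertices, which it
   determines; its faces are the nonempty subsets of its vertex set. *)

Definition affinely_independent (R : realType) (n : nat)
    (s : {fset 'rV[R]_n}) : Prop :=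
  forall t : 'rV[R]_n -> R,
    \sum_(v <- s) t v = 0 -> \sum_(v <- s) t v *: v = 0 ->
    forall v, v \in s -> t v = 0.

Definition is_simplex (R : realType) (n : nat) (s : {fset 'rV[R]_n}) : Prop :=
  s != fset0%fset /\ affinely_independent s.

Definition simplex_dim (R : realType) (n : nat) (s : {fset 'rV[R]_n}) : nat :=
  #|` s|.-1.

Definition open_simplex (R : realType) (n : nat) (s : {fset 'rV[R]_n}) :
    set 'rV[R]_n :=
  [set x | exists t : 'rV[R]_n -> R,
     [/\ forall v, v \in s -> 0 < t v,
         \sum_(v <- s) t v = 1 &
         x = \sum_(v <- s) t v *: v]].

Definition generalized_complex (R : realType) (n : nat)
    (K : {fset {fset 'rV[R]_n}}) : Prop :=
  (forall s, s \in K -> is_simplex s) /\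
  (forall s t, s \in K -> t \in K ->
     closure (open_simplex s) `&` closure (open_simplex t) = set0 \/
     exists f : {fset 'rV[R]_n},
       [/\ f != fset0%fset, (f `<=` s)%fset, (f `<=` t)%fset &
           closure (open_simplex s) `&` closure (open_simplex t) =
           closure (open_simplex f)]).

Definition polyhedron (R : realType) (n : nat) (K : {fset {fset 'rV[R]_n}}) :
    set 'rV[R]_n :=
  \bigcup_(s in [set` K]) open_simplex s.

(* Simplices of R^n have dimension at most n, so i ranges over 0, ..., n. *)
Definition euler_complex (R : realType) (n : nat)
    (K : {fset {fset 'rV[R]_n}}) : int :=
  \sum_(i < n.+1)
     (-1) ^+ i * (#|` [fset s in K | simplex_dim s == i]%fset|)%:Z.

Definition triangulation (R : realType) (n : nat) (K : {fset {fset 'rV[R]_n}})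
    (X : topologicalType) (phi : polyhedron K -> X) : Prop :=
  generalized_complex K /\ homeomorphism phi.

Definition simplex_image (R : realType) (n : nat) (K : {fset {fset 'rV[R]_n}})
    (X : topologicalType) (phi : polyhedron K -> X) (s : {fset 'rV[R]_n}) :
    set X :=
  [set phi x | x in [set x : polyhedron K | open_simplex s (set_val x)]].

Definition compatible (R : realType) (n : nat) (K : {fset {fset 'rV[R]_n}})
    (X : topologicalType) (phi : polyhedron K -> X) (B : set X) : Prop :=
  exists L : {fset {fset 'rV[R]_n}},
    (L `<=` K)%fset /\ B = \bigcup_(s in [set` L]) simplex_image phi s.

Definition definable_triangulation (R : realType) (S : ominimal_structure R)
    (p n : nat) (K : {fset {fset 'rV[R]_p}}) (A : set 'rV[R]_n)
    (phi : polyhedron K -> A) : Prop :=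
  triangulation phi /\ definable_map S phi.

Definition definable_triangulation_theorem (R : realType)
    (S : ominimal_structure R) : Prop :=
  forall (n : nat) (A : set 'rV[R]_n) (N : nat) (F : 'I_N -> set 'rV[R]_n),
    definable S A ->
    (forall i, definable S (F i) /\ F i `<=` A) ->
    exists (p : nat) (K : {fset {fset 'rV[R]_p}}) (phi : polyhedron K -> A),
      definable_triangulation S phi /\
      forall i, compatible phi [set x : A | F i (set_val x)].

(* Stated as a relation: it is single-valued only by [beke_theorem], taken
   with both sets equal. *)
Definition has_euler_characteristic (R : realType) (S : ominimal_structure R)
    (n : nat) (A : set 'rV[R]_n) (e : int) : Prop :=
  exists (p : nat) (K : {fset {fset 'rV[R]_p}}) (phi : polyhedron K -> A),
    definable_triangulation S phi /\ e = euler_complex K.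

Definition beke_theorem (R : realType) (S : ominimal_structure R) : Prop :=
  forall (n m : nat) (A : set 'rV[R]_n) (B : set 'rV[R]_m),
    definable S A -> definable S B ->
    (exists f : A -> B, homeomorphism f) ->
    forall a b : int,
      has_euler_characteristic S A a -> has_euler_characteristic S B b ->
      a = b.

Definition HCF (R : realType) (S : ominimal_structure R) (n : nat)
    (A : set 'rV[R]_n) (X : topologicalType) (beta : X -> A) (h : X -> int) :
    Prop :=
  [/\ exists M : int, forall x, `|h x| <= M,
      compact (closure [set x | h x != 0]) &
      forall c : int,
        definable S [set set_val (beta x) | x in [set x | h x = c]]].

Definition euler_simplex (R : realType) (n : nat) (s : {fset 'rV[R]_n}) : int :=
  (-1) ^+ simplex_dim s.

(* The triangulation of X is an arbitrary one: no compatibility with the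
   o-minimal structure is required. *)
Definition is_euler_integral (R : realType) (X : topologicalType)
    (h : X -> int) (z : int) : Prop :=
  exists (p : nat) (K : {fset {fset 'rV[R]_p}}) (phi : polyhedron K -> X)
         (c : {fset 'rV[R]_p} -> int),
    [/\ triangulation phi,
        forall x, h x = \sum_(s <- K) c s * \1_(simplex_image phi s) x &
        z = \sum_(s <- K) c s * euler_simplex s].

(* A value given by some triangulation of X; 0 when h has no such
   representation. *)
Definition euler_integral (R : realType) (X : topologicalType)
    (h : X -> int) : int :=
  xget 0 [set z | is_euler_integral R h z].

(* Main.v *)
Require Import Defs.
From HB Require Import structures.
From mathcomp Require Import all_boot all_order all_algebra finmap.
From mathcomp Require Import zify.
From mathcomp Require Import all_classical all_reals all_analysis.
Import Order.TTheory GRing.Theory Num.Theory.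
Import numFieldNormedType.Exports.
Set Implicit Arguments.
Unset Strict Implicit.
Unset Printing Implicit Defensive.

Local Open Scope classical_set_scope.
Local Open Scope ring_scope.

(* Additivity is immediate once the integral is known to be well defined: a
   triangulation of A compatible with all level sets of all the h_i represents
   them, and their sum, by combinations of the same open simplices.

   The integral is well defined because, for two representations of h over
   triangulations K and K' of X, the subcomplexes of K and K' on which the
   coefficient is v are both homeomorphic to the level set {h = v}, so it is
   enough that homeomorphic polyhedra have equal characteristics. Beke's theorem
   does not apply to polyhedra directly, since the structure may lack addition
   and multiplication and an open simplex need not be definable. Dividing
   barycentric coordinates by their maximum instead of their sum turns a
   polyhedron into a union of faces of the cube [0, 1]^N, one for each simplex,
   which is definable from the order alone. The characteristic of this model is
   computed by additivity over its faces, each of which is homeomorphic to the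
   order simplex 0 < x_0 < ... < x_(d-1) < 1, a definable open simplex. *)

(** * Homeomorphisms between subspaces *)

Definition homeomorphic (T U : topologicalType) : Prop :=
  exists f : T -> U, homeomorphism f.

Lemma homeomorphic_sym (T U : topologicalType) :
  homeomorphic T U -> homeomorphic U T.
Proof.
by move=> [f [cf [g [cg fK gK]]]]; exists g; split=> //; exists f.
Qed.

Lemma homeomorphism_comp (T U V : topologicalType) (f : T -> U) (g : U -> V) :
  homeomorphism f -> homeomorphism g -> homeomorphism (g \o f).
Proof.
move=> [cf [f' [cf' fK fK']]] [cg [g' [cg' gK gK']]]; split.
  by move=> x; apply: continuous_comp; [exact: cf|exact: cg].
exists (f' \o g'); split.
- by move=> x; apply: continuous_comp; [exact: cg'|exact: cf'].
- exact: can_comp.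
- exact: can_comp.
Qed.

Lemma homeomorphic_trans (T U V : topologicalType) :
  homeomorphic T U -> homeomorphic U V -> homeomorphic T V.
Proof.
by move=> [f hf] [g hg]; exists (g \o f); exact: homeomorphism_comp.
Qed.

Lemma set_val_in {T : Type} {A : set T} (x : A) : A (set_val x).
Proof. exact: set_valP. Qed.

Definition to_set {T : Type} {A : set T} {x : T} (Ax : A x) : A :=
  exist _ x (mem_set Ax).

Lemma set_val_inj (T : Type) (A : set T) : injective (set_val : A -> T).
Proof. by move=> x y; exact: val_inj. Qed.

Lemma continuous_to_set_type (T U : topologicalType) (B : set U) (f : T -> B) :
  continuous (set_val \o f) -> continuous f.
Proof. exact: (@continuous_comp_initial B T U set_val). Qed.

Lemma set_val_continuous (T : topologicalType) (A : set T) :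
  continuous (set_val : A -> T).
Proof. exact: initial_continuous. Qed.

(** The last clause ties [f'] to [f] through underlying points, since [A'] and [A] are different
    types; it lets the graph of [f'] be cut out of the graph of [f]. *)
Lemma homeomorphism_restrict (T U : topologicalType) (A A' : set T)
    (B B' : set U) (f : A -> B) :
  homeomorphism f -> A' `<=` A -> B' `<=` B ->
  (forall x, A' (set_val x) <-> B' (set_val (f x))) ->
  exists f' : A' -> B', homeomorphism f' /\
    forall x' x, set_val x' = set_val x -> set_val (f' x') = set_val (f x).
Proof.
move=> [cf [g [cg fK gK]]] sA sB AB.
pose iA (x : A') : A := to_set (sA _ (set_val_in x)).
pose iB (x : B') : B := to_set (sB _ (set_val_in x)).
have fP (x : A') : B' (set_val (f (iA x))).
  exact: (AB (iA x)).1 (set_val_in x).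
have gP (y : B') : A' (set_val (g (iB y))).
  by apply: (AB _).2; rewrite gK; exact: (set_val_in y).
have ciA : continuous iA.
  by apply: continuous_to_set_type; exact: set_val_continuous.
have ciB : continuous iB.
  by apply: continuous_to_set_type; exact: set_val_continuous.
exists (fun x => to_set (fP x)); split; last first.
  move=> x' x xx'; rewrite /=; congr (set_val (f _)).
  by apply: set_val_inj.
split.
  apply: continuous_to_set_type => x.
  have cfi : {for x, continuous (f \o iA)}.
    by apply: continuous_comp; [exact: ciA|exact: cf].
  exact: (continuous_comp cfi (@set_val_continuous _ _ _)).
exists (fun x => to_set (gP x)); split.
- apply: continuous_to_set_type => x.
  have cgi : {for x, continuous (g \o iB)}.
    by apply: continuous_comp; [exact: ciB|exact: cg].
  exact: (continuous_comp cgi (@set_val_continuous _ _ _)).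
- move=> x; apply: set_val_inj; change (set_val x) with (set_val (iA x)).
  by rewrite -[in RHS](fK (iA x)); congr (set_val (g _)); exact: set_val_inj.
- move=> y; apply: set_val_inj; change (set_val y) with (set_val (iB y)).
  by rewrite -[in RHS](gK (iB y)); congr (set_val (f _)); exact: set_val_inj.
Qed.

(* A continuous injection of a compact set into a Hausdorff space maps closed
   sets to closed sets, so its inverse is continuous. *)
Lemma homeomorphic_image (T U : topologicalType) (C D : set T) (f : T -> U) :
  hausdorff_space U -> compact C ->
  (forall x, C x -> {for x, continuous f}) ->
  (forall x y, C x -> C y -> f x = f y -> x = y) ->
  D `<=` C -> homeomorphic D (f @` D).
Proof.
move=> hU cC cf finj DC.
have fP (x : D) : (f @` D) (f (set_val x)).
  by exists (set_val x) => //; exact: set_val_in.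
have gP (y : f @` D) : exists x : D, f (set_val x) = set_val y.
  by have [x Dx xy] := set_val_in y; exists (to_set Dx).
pose g y := projT1 (cid (gP y)).
have gE y : f (set_val (g y)) = set_val y by exact: projT2 (cid (gP y)).
have CD (x : D) : C (set_val x) by apply: DC; exact: set_val_in.
exists (fun x => to_set (fP x)); split.
  apply: continuous_to_set_type => x.
  apply: (@continuous_comp _ _ _ set_val f); first exact: set_val_continuous.
  exact: cf.
exists g; split.
- apply: continuous_to_set_type => y W; rewrite nbhsE => -[V [oV Vy] VW].
  have KO : compact (f @` (C `\` V)).
    apply: continuous_compact; last first.
      by rewrite setDE; apply: compact_closedI => //; exact: open_closedC.
    apply: continuous_in_subspaceT => x /set_mem[Cx _]; exact: cf.
  have /closed_openC oK := compact_closed hU KO.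
  exists (set_val @^-1` ~` (f @` (C `\` V))); split.
  - by exists (~` (f @` (C `\` V))).
  - rewrite /= => -[x [Cx nVx]]; rewrite -gE => /finj xy.
    by apply: nVx; rewrite (xy Cx (CD _)).
  - move=> y' /= ny'; apply: VW; apply: contrapT => nV; apply: ny'.
    by exists (set_val (g y')).
- by move=> x; apply: set_val_inj; apply: finj; rewrite ?gE.
- by move=> y; apply: set_val_inj; exact: gE.
Qed.

(** * Barycentric coordinates and the cube model *)

(** Coordinates in the closed simplex, extended by 0 off [s], so that the coordinates of one point
    in different simplices can be compared as functions. *)
Definition barycentric (R : realType) (p : nat) (s : {fset 'rV[R]_p})
    (t : 'rV[R]_p -> R) (y : 'rV[R]_p) : Prop :=
  [/\ forall v, 0 <= t v, forall v, v \notin s -> t v = 0,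
      \sum_(v <- s) t v = 1 & y = \sum_(v <- s) t v *: v].

Lemma open_simplexP (R : realType) (p : nat) (s : {fset 'rV[R]_p}) y :
  open_simplex s y <->
  exists t, barycentric s t y /\ forall v, v \in s -> 0 < t v.
Proof.
split=> [[t [t0 t1 ty]]|[t [[t0 _ t1 ty] tp]]]; last by exists t.
exists (fun v => if v \in s then t v else 0); split; last first.
  by move=> v vs; rewrite vs; exact: t0.
split.
- by move=> v; case: ifPn => // vs; exact/ltW/t0.
- by move=> v /negbTE ->.
- by rewrite -t1; apply: eq_big_seq => v ->.
- by rewrite ty; apply: eq_big_seq => v ->.
Qed.

Lemma barycentric_incl (R : realType) (p : nat) (f s : {fset 'rV[R]_p}) t y :
  (f `<=` s)%fset -> barycentric f t y -> barycentric s t y.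
Proof.
move=> fs [t0 tf t1 ty]; split=> //.
- by move=> v vs; apply: tf; apply: contra vs => /(fsubsetP fs).
- rewrite -t1; apply/esym/big_fset_incl => // v _ vf.
  exact: tf.
- rewrite ty; apply/big_fset_incl => // v _ vf.
  by rewrite tf ?scale0r.
Qed.

Lemma barycentric_uniq (R : realType) (p : nat) (s : {fset 'rV[R]_p}) t t' y :
  affinely_independent s -> barycentric s t y -> barycentric s t' y -> t = t'.
Proof.
move=> ai [_ ts t1 ty] [_ ts' t1' ty']; apply/funext => v.
have [vs|vs] := boolP (v \in s); last by rewrite ts ?ts'.
apply/eqP; rewrite -subr_eq0; apply/eqP.
apply: (ai (fun v => t v - t' v)) => //.
  by rewrite sumrB t1 t1' subrr.
under eq_bigr do rewrite scalerBl.
by rewrite sumrB -ty -ty' subrr.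
Qed.

Lemma continuous_sum (T : topologicalType) (R : realType)
    (V : normedModType R) (I : Type) (r : seq I) (F : I -> T -> V) x :
  (forall i, {for x, continuous (F i)}) ->
  {for x, continuous (fun y => \sum_(i <- r) F i y)}.
Proof.
move=> cF; suff : \sum_(i <- r) F i y @[y --> x] --> \sum_(i <- r) F i x by [].
elim: r => [|i r IH].
  by under eq_fun do rewrite big_nil; rewrite big_nil; exact: cvg_cst.
rewrite big_cons; under eq_fun do rewrite big_cons.
by apply: cvgD => //; exact: cF.
Qed.

Section CubeModel.
Context (R : realType) (N p : nat) (w : 'I_N -> 'rV[R]_p).
Hypothesis w_inj : injective w.

(* The union of the faces, spanned by the coordinates in [a], of the cube
   [0, 1]^N not containing the origin: a copy of the closed simplex obtained
   by normalizing barycentric coordinates to have maximum 1 instead of sum 1. *)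
Definition cube_cone (a : {set 'I_N}) : set 'rV[R]_N :=
  [set x | (exists i, x ord0 i = 1) /\
           forall i, 0 <= x ord0 i /\ x ord0 i <= (i \in a)%:R].

Lemma compact_cube_cone a : compact (cube_cone a).
Proof.
(* The box [F i] is the part where coordinate [i] equals 1; it is empty if [i] is not in [a]. *)
pose B (i j : 'I_N) : set R := `[(j == i)%:R, (j \in a)%:R]%classic.
pose F i := [set x : 'rV[R]_N | forall j, B i j (x ord0 j)].
suff -> : cube_cone a = \big[setU/set0]_(i : 'I_N) F i.
  apply: bigsetU_compact => i _; apply: rV_compact => j.
  exact: segment_compact.
apply/seteqP; split=> x.
  move=> [[i xi] xb]; rewrite (bigD1 i)//=; left => j.
  rewrite /B /= in_itv /=; have [xj0 xja] := xb j.
  by rewrite xja andbT; case: eqP => [->|//]; rewrite xi.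
rewrite -bigcup_seq => -[i _ Fx].
have {}Fx j : (j == i)%:R <= x ord0 j /\ x ord0 j <= (j \in a)%:R.
  by have := Fx j; rewrite /B /= in_itv /= => /andP.
split=> [|j]; last first.
  by have [h1 h2] := Fx j; split=> //; apply: le_trans h1; exact: ler0n.
exists i; have [h1 h2] := Fx i; apply/eqP; rewrite eq_le.
rewrite eqxx in h1; rewrite h1 andbT (le_trans h2)//.
by case: (i \in a).
Qed.

(** The point whose barycentric coordinates are proportional to [x]: it passes from maximum 1 back
    to sum 1. *)
Definition cube_center (x : 'rV[R]_N) : 'rV[R]_p :=
  (\sum_i x ord0 i)^-1 *: \sum_i x ord0 i *: w i.

Lemma cube_cone_sum_gt0 a x : cube_cone a x -> 0 < \sum_i x ord0 i.
Proof.
move=> [[i xi] xb]; rewrite (bigD1 i)//= xi ltr_pwDl//.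
by apply: sumr_ge0 => j _; case: (xb j).
Qed.

Lemma cube_center_continuous a x :
  cube_cone a x -> {for x, continuous cube_center}.
Proof.
move=> /cube_cone_sum_gt0 sx.
have c1 : (\sum_i y ord0 i)^-1 @[y --> x] --> (\sum_i x ord0 i)^-1.
  have c0 : \sum_i y ord0 i @[y --> x] --> \sum_i x ord0 i.
    apply: (@continuous_sum _ _ R^o _ _ (fun i (y : 'rV[R]_N) => y ord0 i)).
    by move=> i; exact: coord_continuous.
  by apply: (cvgV _ c0); rewrite gt_eqF.
have c2 : \sum_i y ord0 i *: w i @[y --> x] --> \sum_i x ord0 i *: w i.
  apply: (@continuous_sum _ _ _ _ _ (fun i (y : 'rV[R]_N) => y ord0 i *: w i)).
  move=> i.
  have ci : y ord0 i @[y --> x] --> x ord0 i by exact: coord_continuous.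
  exact: cvgZr_tmp ci.
exact: cvgZ c1 c2.
Qed.

Context (s : {fset 'rV[R]_p}).
Hypothesis w_s : forall v, v \in s -> exists i, w i = v.
Let a := [set i | w i \in s]%SET.

(** [w] may enumerate more points than the vertices of [s], as it will be shared by all simplices of
    a complex; hence the vanishing condition. *)
Lemma sum_vertices (V : nmodType) (F : 'rV[R]_p -> V) :
  (forall i, w i \notin s -> F (w i) = 0) ->
  \sum_(v <- s) F v = \sum_i F (w i).
Proof.
move=> F0.
have /(perm_big _) -> : perm_eq s [seq w i | i <- enum 'I_N & w i \in s].
  apply: uniq_perm => //.
    by rewrite map_inj_uniq// filter_uniq// enum_uniq.
  move=> v; apply/idP/mapP => [vs|[i]]; last first.
    by rewrite mem_filter => /andP[+ _] ->.
  have [i wi] := w_s vs; exists i => //.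
  by rewrite mem_filter wi vs mem_enum.
rewrite big_map big_filter big_enum_cond/= big_mkcond/=.
by apply: eq_bigr => i _; case: ifPn => // /F0.
Qed.

(** The coordinates are those of [x] divided by their sum. The factor [c] is recorded because the
    injectivity of [cube_center] rests on it. *)
Lemma barycentric_cube_center x : cube_cone a x ->
  exists t, barycentric s t (cube_center x) /\
    exists c, 0 < c /\ forall i, t (w i) = c * x ord0 i.
Proof.
move=> Cx; have sx := cube_cone_sum_gt0 Cx.
have [_ xb] := Cx.
set c := (\sum_i x ord0 i)^-1.
have c0 : 0 < c by rewrite invr_gt0.
(* Inverts [w] where possible; points outside the image of [w] are not vertices, so they get 0. *)
pose t v := if [pick i | w i == v] is Some i then c * x ord0 i else 0.
have tE i : t (w i) = c * x ord0 i.
  rewrite /t; case: pickP => [j /eqP/w_inj -> //|/(_ i)].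
  by rewrite eqxx.
have x0 i : w i \notin s -> x ord0 i = 0.
  move=> wi; have [h1 h2] := xb i; apply/eqP; rewrite eq_le h1 andbT.
  by rewrite (le_trans h2)// inE (negbTE wi).
exists t; split; last by exists c.
split.
- move=> v; rewrite /t; case: pickP => // i _.
  by rewrite mulr_ge0 ?(ltW c0)//; case: (xb i).
- move=> v vs; rewrite /t; case: pickP => // i /eqP wi.
  by rewrite x0 ?mulr0// wi.
- rewrite sum_vertices => [|i wi]; last by rewrite tE x0 ?mulr0.
  under eq_bigr do rewrite tE.
  by rewrite -mulr_sumr mulVf// gt_eqF.
- rewrite sum_vertices => [|i wi]; last by rewrite tE x0 ?mulr0 ?scale0r.
  under eq_bigr do rewrite tE -scalerA.
  by rewrite -scaler_sumr.
Qed.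

(** Dividing the coordinates by the largest one gives a preimage in the cone. *)
Lemma cube_center_surj t y : barycentric s t y ->
  exists x, [/\ cube_cone a x, cube_center x = y &
    exists c, 0 < c /\ forall i, x ord0 i = c * t (w i)].
Proof.
move=> [t0 ts t1 ty].
have tw0 i : w i \notin s -> t (w i) = 0 by exact: ts.
have st : \sum_i t (w i) = 1 by rewrite -sum_vertices.
have [i0 _] : exists i, t (w i) <> 0.
  apply/existsNP => tw; move: st; rewrite big1 => [/eqP|//].
  by rewrite eq_sym oner_eq0.
pose i := [arg max_(j > i0) t (w j)]%O.
have ti j : t (w j) <= t (w i).
  by rewrite /i; case: arg_maxP => // k _; exact.
have ti0 : 0 < t (w i).
  rewrite lt_neqAle t0 andbT; apply/eqP => ti0.
  move: st; rewrite big1 => [/eqP|j _]; first by rewrite eq_sym oner_eq0.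
  by apply/eqP; rewrite eq_le t0 andbT ti0.
pose x : 'rV[R]_N := \row_j ((t (w i))^-1 * t (w j)).
have xE j : x ord0 j = (t (w i))^-1 * t (w j) by rewrite mxE.
exists x; split; last by exists (t (w i))^-1; rewrite invr_gt0.
- split; first by exists i; rewrite xE mulVf// gt_eqF.
  move=> j; rewrite xE mulr_ge0 ?invr_ge0 ?t0//; split=> //.
  rewrite inE; have [wj|/tw0 ->] := boolP (w j \in s); last by rewrite mulr0.
  by rewrite mulrC ler_pdivrMr// mul1r.
- rewrite /cube_center.
  under eq_bigr do rewrite xE.
  rewrite -mulr_sumr st mulr1 invrK.
  under eq_bigr do rewrite xE -scalerA.
  rewrite -scaler_sumr scalerA mulfV ?gt_eqF// scale1r ty sum_vertices//.
  by move=> j /tw0 ->; rewrite scale0r.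
Qed.

End CubeModel.

Lemma open_simplex_nonempty (R : realType) (p : nat) (s : {fset 'rV[R]_p}) :
  s != fset0%fset -> exists y, open_simplex s y.
Proof.
(* The barycenter. *)
move=> s0; exists (\sum_(v <- s) (#|` s|%:R)^-1 *: v).
have sg0 : (0 < #|` s|)%N by rewrite cardfs_gt0.
exists (fun=> (#|` s|%:R)^-1); split=> //.
  by move=> v _; rewrite invr_gt0 ltr0n.
rewrite big_const_seq count_predT iter_addr_0.
by rewrite -[LHS]mulr_natr mulVf// pnatr_eq0 -lt0n.
Qed.

Lemma fset_enumeration (T : choiceType) (V : {fset T}) (x0 : T) :
  exists w : 'I_#|` V| -> T, [/\ injective w, forall i, w i \in V &
    forall v, v \in V -> exists i, w i = v].
Proof.
exists (fun i => nth x0 V i); split.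
- by move=> i j /eqP; rewrite nth_uniq ?fset_uniq// => /eqP/val_inj.
- by move=> i; rewrite mem_nth.
- move=> v vV; have vi : (index v V < #|` V|)%N by rewrite index_mem.
  by exists (Ordinal vi); rewrite /= nth_index.
Qed.

(** The set on the right is closed, being the image of the compact [cube_cone]. Conversely, moving a
    point of it slightly towards a point of the open simplex makes all coordinates positive. *)
Lemma closure_open_simplex (R : realType) (p : nat) (s : {fset 'rV[R]_p}) :
  s != fset0%fset ->
  closure (open_simplex s) = [set y | exists t, barycentric s t y].
Proof.
move=> s0; apply/seteqP; split.
  have [w [w_inj _ w_s]] := fset_enumeration s 0.
  set C := [set y | _].
  have -> : C = cube_center w @` cube_cone [set i | w i \in s]%SET.
    apply/seteqP; split=> [y [t ty]|y [x Cx <-]].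
      by have [x [Cx xy _]] := cube_center_surj w_inj w_s ty; exists x.
    by have [t [ty _]] := barycentric_cube_center w_inj w_s Cx; exists t.
  rewrite closureEbigcap; apply: bigcap_inf; split.
    apply: compact_closed; first exact: norm_hausdorff.
    apply: continuous_compact; last exact: compact_cube_cone.
    apply: continuous_in_subspaceT => x /set_mem Cx.
    exact: cube_center_continuous Cx.
  move=> y /open_simplexP [t [ty _]].
  by have [x [Cx xy _]] := cube_center_surj w_inj w_s ty; exists x.
move=> y [t ty].
have [u /open_simplexP[t' [tu t'0]]] := open_simplex_nonempty s0.
have cy : y + e *: (u - y) @[e --> 0^'+] --> y.
  have cy0 : y + e *: (u - y) @[e --> (0 : R)] --> y + 0 *: (u - y).
    apply: cvgD; first exact: cvg_cst.
    by apply: cvgZr_tmp; exact: cvg_id.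
  by rewrite scale0r addr0 in cy0; exact: cvg_at_right_filter cy0.
apply: (closed_cvg (closure (open_simplex s)) _ _ _ cy).
  exact: closed_closure.
near=> e; apply: subset_closure.
have e0 : 0 < e by near: e; exact: nbhs_right_gt.
have e1 : e < 1 by near: e; exact: nbhs_right_lt.
have [tp ts t1 yE] := ty; have [_ _ t'1 uE] := tu.
exists (fun v => (1 - e) * t v + e * t' v); split.
- move=> v vs; rewrite ltr_wpDl// ?mulr_gt0 ?t'0//.
  by rewrite mulr_ge0// subr_ge0 ltW.
- by rewrite big_split/= -!mulr_sumr t1 t'1 !mulr1 subrK.
- under eq_bigr do rewrite scalerDl -!scalerA.
  rewrite big_split/= -!scaler_sumr -yE -uE scalerBl scale1r scalerBr.
  by rewrite addrAC -addrA.
Unshelve. all: by end_near. Qed.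

(** The closures meet in the closure of a common face [f]; the coordinates of [y] in [f] are, by
    uniqueness, its coordinates in [s] and in [s']. *)
Lemma complex_barycentric_eq (R : realType) (p : nat)
    (K : {fset {fset 'rV[R]_p}}) s s' t t' y :
  generalized_complex K -> s \in K -> s' \in K ->
  barycentric s t y -> barycentric s' t' y -> t = t'.
Proof.
move=> [Ks Kc] sK s'K ty t'y.
have [s0 sai] := Ks _ sK; have [s'0 s'ai] := Ks _ s'K.
have ycl : (closure (open_simplex s) `&` closure (open_simplex s')) y.
  by rewrite !closure_open_simplex//; split; [exists t|exists t'].
have [E|[f [f0 fs fs' E]]] := Kc _ _ sK s'K; rewrite E in ycl => //.
rewrite closure_open_simplex// in ycl; have [r ry] := ycl.
rewrite (barycentric_uniq sai ty (barycentric_incl fs ry)).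
by rewrite (barycentric_uniq s'ai t'y (barycentric_incl fs' ry)).
Qed.

(** A point of an open simplex determines the vertices: they are where its coordinates are
    positive. *)
Lemma open_simplex_disjoint (R : realType) (p : nat)
    (K : {fset {fset 'rV[R]_p}}) s s' y :
  generalized_complex K -> s \in K -> s' \in K ->
  open_simplex s y -> open_simplex s' y -> s = s'.
Proof.
move=> Kc sK s'K /open_simplexP[t [ty tp]] /open_simplexP[t' [t'y t'p]].
have tt' := complex_barycentric_eq Kc sK s'K ty t'y; subst t'.
have [_ ts _ _] := ty; have [_ ts' _ _] := t'y.
apply/fsetP => v; apply/idP/idP => [/tp|/t'p] tv.
  by apply: contraT => /ts' v0; rewrite v0 ltxx in tv.
by apply: contraT => /ts v0; rewrite v0 ltxx in tv.
Qed.

Lemma generalized_complex_sub (R : realType) (p : nat)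
    (K L : {fset {fset 'rV[R]_p}}) :
  (L `<=` K)%fset -> generalized_complex K -> generalized_complex L.
Proof.
move=> /fsubsetP LK [Ks Kc]; split=> [s /LK|s t /LK sK /LK tK]; first exact: Ks.
exact: Kc.
Qed.

(** The image of an open simplex under normalization to maximum 1; [a] is the set of positive
    coordinates. *)
Definition cube_face (R : realType) (N : nat) (a : {set 'I_N}) : set 'rV[R]_N :=
  [set x : 'rV[R]_N | (exists i, x ord0 i = 1) /\
     forall i, x ord0 i <= 1 /\
       if i \in a then is_true (0 < x ord0 i) else x ord0 i = 0].

(** A single [w] is meant to enumerate the vertices of all simplices, so that all faces lie in one
    cube. *)
Definition cube_model (R : realType) (N p : nat) (w : 'I_N -> 'rV[R]_p)
    (L : {fset {fset 'rV[R]_p}}) : set 'rV[R]_N :=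
  \bigcup_(s in [set` L]) cube_face [set i | w i \in s]%SET.

Lemma cube_face_cone (R : realType) (N : nat) (a : {set 'I_N}) :
  @cube_face R N a `<=` cube_cone a.
Proof.
move=> x [x1 xb]; split=> // i; have [] := xb i.
by case: (i \in a) => [h /ltW //|_ ->].
Qed.

(** [cube_center] is continuous and injective on the compact union [C] of the closed cones, and
    [homeomorphic_image] restricts it to the model, which need not be compact. *)
Lemma homeomorphic_cube_model (R : realType) (N p : nat)
    (w : 'I_N -> 'rV[R]_p) (L : {fset {fset 'rV[R]_p}}) :
  generalized_complex L -> injective w ->
  (forall s v, s \in L -> v \in s -> exists i, w i = v) ->
  homeomorphic (cube_model w L) (polyhedron L).
Proof.
move=> Lc w_inj w_L.
pose C : set 'rV[R]_N :=
  \bigcup_(s in [set` L]) cube_cone [set i | w i \in s]%SET.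
have DC : cube_model w L `<=` C.
  by move=> x [s sL xs]; exists s => //; exact: cube_face_cone.
suff E : polyhedron L = cube_center w @` cube_model w L.
  rewrite E; apply: homeomorphic_image DC.
  - exact: norm_hausdorff.
  - rewrite /C bigcup_fset.
    by apply: bigsetU_compact => s _; exact: compact_cube_cone.
  - by move=> x [s sL Cx]; exact: cube_center_continuous Cx.
  - move=> x x' [s sL Cx] [s' s'L Cx'] xx'.
    have [t [ty [c [c0 tc]]]] := barycentric_cube_center w_inj (w_L s ^~ sL) Cx.
    have [t' [ty' [c' [c'0 tc']]]] :=
      barycentric_cube_center w_inj (w_L s' ^~ s'L) Cx'.
    rewrite -xx' in ty'.
    have tt' := complex_barycentric_eq Lc sL s'L ty ty'; subst t'.
    have cx i : c * x ord0 i = c' * x' ord0 i by rewrite -tc -tc'.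
    have [[i xi] xb] := Cx; have [[j xj] xb'] := Cx'.
    (* Both points have largest coordinate 1, so evaluating at a coordinate where one of them is 1
       bounds each factor by the other. *)
    have cc' : c = c'.
      apply/eqP; rewrite eq_le; apply/andP; split.
        have := cx i; rewrite xi mulr1 => ->; rewrite ler_piMr ?(ltW c'0)//.
        by have [_ /le_trans] := xb' i; apply; case: (_ \in _).
      have := cx j; rewrite xj mulr1 => <-; rewrite ler_piMr ?(ltW c0)//.
      by have [_ /le_trans] := xb j; apply; case: (_ \in _).
    apply/rowP => k; apply: (mulfI (lt0r_neq0 c0)).
    by rewrite cx cc'.
apply/seteqP; split=> y.
  move=> [s sL /open_simplexP [t [ty tp]]].
  have [x [Cx xy [c [c0 xc]]]] := cube_center_surj w_inj (w_L s ^~ sL) ty.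
  exists x => //; exists s => //; have [x1 xb] := Cx; split=> // i.
  have [_ xi] := xb i; split; first by apply: le_trans xi _; case: (_ \in _).
  rewrite inE xc; case: ifPn => [/tp|wi]; first by move=> ?; exact: mulr_gt0.
  by have [_ -> //] := ty; rewrite mulr0.
move=> [x [s sL xF] <-]; exists s => //.
have [t [ty [c [c0 tc]]]] :=
  barycentric_cube_center w_inj (w_L s ^~ sL) (cube_face_cone xF).
apply/open_simplexP; exists t; split=> // v vs.
have [i wi] := w_L _ _ sL vs; rewrite -wi tc mulr_gt0//.
by have [_ /(_ i)[_]] := xF; rewrite inE wi vs.
Qed.

(** * Definability calculus *)

Section Definability.
Context (R : realType) (S : ominimal_structure R).

Lemma definable_setT n : definable S [set: 'rV[R]_n].
Proof. by rewrite -setC0; apply/definable_setC/definable_set0. Qed.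

Lemma definable_setI n (A B : set 'rV[R]_n) :
  definable S A -> definable S B -> definable S (A `&` B).
Proof.
move=> dA dB; rewrite -[A `&` B]setCK setCI.
by apply/definable_setC/definable_setU; exact: definable_setC.
Qed.

Lemma definable_exists n (I : finType) (P : I -> set 'rV[R]_n) :
  (forall i, definable S (P i)) -> definable S [set x | exists i, P i x].
Proof.
move=> dP; have -> : [set x | exists i, P i x] = \big[setU/set0]_(i : I) P i.
  rewrite -bigcup_seq; apply/seteqP; split=> x [i]; last by exists i.
  by exists i => //=; rewrite mem_index_enum.
elim/big_ind: _ => //; [exact: definable_set0|exact: definable_setU].
Qed.

Lemma definable_forall n (I : finType) (P : I -> set 'rV[R]_n) :
  (forall i, definable S (P i)) -> definable S [set x | forall i, P i x].
Proof.
move=> dP.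
have -> : [set x | forall i, P i x] = ~` [set x | exists i, (~` P i) x].
  apply/seteqP; split=> x /=; first by move=> Px [i]; apply.
  by move=> nP i; apply: contrapT => nPi; apply: nP; exists i.
apply: definable_setC; apply: definable_exists => i; exact: definable_setC.
Qed.

(** Projection along the last coordinate is iterated [m] times. The free dimension [k] and the
    comparison of indices as naturals avoid casts between [n + m.+1] and [n + m + 1]. *)
Lemma definable_initial_coords m n k (A : set 'rV[R]_k) : k = (n + m)%N ->
  definable S A ->
  definable S [set x : 'rV[R]_n | exists z, A z /\
    forall (i : 'I_n) (j : 'I_k), i = j :> nat -> x ord0 i = z ord0 j].
Proof.
elim: m k A => [|m IH] k A.
  rewrite addn0 => ?; subst k => dA.
  rewrite (_ : [set x | _] = A)//; apply/seteqP; split=> [x [z [Az xz]]|x Ax].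
    by rewrite (_ : x = z)//; apply/rowP => i; exact: xz.
  by exists x; split=> // i j /val_inj ->.
rewrite addnS -addn1 => ?; subst k => dA.
have := IH _ _ erefl (definable_proj dA); congr (definable S _).
apply/seteqP; split=> x [z].
  move=> [[z' Az' <-] xz]; exists z'; split=> // i j ij.
  have jk : (j < n + m)%N by rewrite -ij ltn_addr.
  rewrite (xz i (Ordinal jk))//= mxE; congr (z' _ _); exact: val_inj.
move=> [Az xz]; exists (lsubmx z); split; first by exists z.
by move=> i j ij; rewrite mxE; exact: xz.
Qed.

Lemma definable_lsubmx n m (A : set 'rV[R]_(n + m)) :
  definable S A -> definable S [set lsubmx z | z in A].
Proof.
move=> /(definable_initial_coords erefl); congr (definable S _).
apply/seteqP; split=> x [z].
  move=> [Az xz]; exists z => //; apply/rowP => i.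
  by rewrite mxE; apply/esym/xz.
move=> Az <-; exists z; split=> // i j ij; rewrite mxE; congr (z _ _).
exact: val_inj.
Qed.

Lemma definable_eq_coord n (i j : 'I_n) :
  definable S [set x : 'rV[R]_n | x ord0 i = x ord0 j].
Proof.
have [ij|ji|/val_inj ->] := ltngtP i j.
- exact: definable_diag.
- by have := definable_diag S ji; congr (definable S _); apply/seteqP; split.
- by have := definable_setT n; congr (definable S _); apply/seteqP; split.
Qed.

(** Projects the set of pairs of [x] in R^n and [y] in [B] with [y_j = x_(f j)] for all [j]. *)
Lemma definable_preimage_coords n m (f : 'I_m -> 'I_n) (B : set 'rV[R]_m) :
  definable S B -> definable S [set x : 'rV[R]_n | B (\row_j x ord0 (f j))].
Proof.
move=> dB; pose A := [set z : 'rV[R]_(n + m) | setT (lsubmx z) /\ B (rsubmx z)]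
  `&` [set z | forall j, z ord0 (lshift m (f j)) = z ord0 (rshift n j)].
have dA : definable S A.
  apply: definable_setI; first exact: definable_prod (definable_setT n) dB.
  by apply: definable_forall => j; exact: definable_eq_coord.
have := definable_lsubmx dA; congr (definable S _); apply/seteqP; split=> x.
  move=> [z [[_ Bz] zE] <-] /=; rewrite (_ : \row_j _ = rsubmx z)//.
  by apply/rowP => j; rewrite !mxE.
move=> Bx; exists (row_mx x (\row_j x ord0 (f j))); last by rewrite row_mxKl.
split; first by rewrite /= row_mxKr.
by move=> j; rewrite row_mxEl row_mxEr mxE.
Qed.

Lemma definable_coord_interval n (i : 'I_n) (a b : \bar R) :
  definable S
    [set x : 'rV[R]_n | (a < (x ord0 i)%:E)%E /\ ((x ord0 i)%:E < b)%E].
Proof.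
have dB : definable S
    [set x : 'rV[R]_1 | (a < (x ord0 ord0)%:E)%E /\ ((x ord0 ord0)%:E < b)%E].
  apply/definable_line.
  exists 1%N, (fun=> [set x | (a < x%:E)%E /\ (x%:E < b)%E]).
  split; first by move=> _; right; exists a, b.
  apply/seteqP; split=> x; first by move=> [z zab <-]; exists ord0.
  by move=> [_ xab]; exists (\row__ x); rewrite /= ?mxE.
have := definable_preimage_coords (fun=> i) dB; congr (definable S _).
by apply/seteqP; split=> x /=; rewrite mxE.
Qed.

Lemma definable_coord_eq n (i : 'I_n) (c : R) :
  definable S [set x : 'rV[R]_n | x ord0 i = c].
Proof.
have := definable_setC (definable_setU (definable_coord_interval i -oo c%:E)
  (definable_coord_interval i c%:E +oo)); congr (definable S _).
apply/seteqP; split=> x /=; rewrite !lte_fin ltNyr ltry.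
  move=> /not_orP[h1 h2]; apply/eqP; rewrite eq_le !leNgt.
  by apply/andP; split; apply/negP => h; [apply: h2|apply: h1].
by move=> ->; rewrite ltxx => -[[]|[]].
Qed.

Lemma definable_coord_gt n (i : 'I_n) (c : R) :
  definable S [set x : 'rV[R]_n | c < x ord0 i].
Proof.
have := definable_coord_interval i c%:E +oo; congr (definable S _).
by apply/seteqP; split=> x /=; rewrite !lte_fin ltry // => -[].
Qed.

Lemma definable_coord_lt n (i : 'I_n) (c : R) :
  definable S [set x : 'rV[R]_n | x ord0 i < c].
Proof.
have := definable_coord_interval i -oo c%:E; congr (definable S _).
by apply/seteqP; split=> x /=; rewrite !lte_fin ltNyr // => -[].
Qed.

Lemma definable_lt_coords n (i j : 'I_n) :
  definable S [set x : 'rV[R]_n | x ord0 i < x ord0 j].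
Proof.
have := definable_preimage_coords (fun k : 'I_2 => if k == ord0 then i else j)
  (definable_lt S); congr (definable S _).
by apply/seteqP; split=> x /=; rewrite !mxE.
Qed.

Lemma definable_cube_face n (a : {set 'I_n}) : definable S (@cube_face R n a).
Proof.
apply: definable_setI.
  by apply: definable_exists => i; exact: definable_coord_eq.
apply: definable_forall => i; apply: definable_setI.
  have := definable_setC (definable_coord_gt i 1); congr (definable S _).
  by apply/seteqP; split=> x /=; rewrite leNgt => /negP.
by case: (i \in a); [exact: definable_coord_gt|exact: definable_coord_eq].
Qed.

Lemma definable_cube_model n p (w : 'I_n -> 'rV[R]_p)
    (L : {fset {fset 'rV[R]_p}}) : definable S (cube_model w L).
Proof.
rewrite /cube_model bigcup_fset.
elim/big_ind: _ => [||s _]; first exact: definable_set0.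
- by move=> A B; exact: definable_setU.
- exact: definable_cube_face.
Qed.

End Definability.

(** * Order simplices *)

Section OrderSimplex.
Context (R : realType) (d : nat).

(** Zeros before position [i] and ones from there on: vertex 0 is the all-ones vector and vertex [d]
    the origin. Combinations then have partial sums of the weights as coordinates. *)
Definition order_vertex (i : 'I_d.+1) : 'rV[R]_d := \row_j (i <= j)%N%:R.

Definition order_simplex : {fset 'rV[R]_d} :=
  [fset order_vertex i | i in 'I_d.+1]%fset.

Lemma order_vertex_inj : injective order_vertex.
Proof.
have lt_neq (i i' : 'I_d.+1) : (i < i')%N -> order_vertex i <> order_vertex i'.
  move=> ii'; have id : (i < d)%N by rewrite (leq_trans ii')// -ltnS.
  move=> /rowP/(_ (Ordinal id)); rewrite !mxE leqnn leqNgt ii' => /eqP.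
  by rewrite oner_eq0.
move=> i i' E; apply/val_inj; have [/lt_neq|/lt_neq|//] := ltngtP i i'.
  by [].
by move=> /(_ (esym E)).
Qed.

Lemma mem_order_vertex i : order_vertex i \in order_simplex.
Proof. by apply/imfsetP; exists i. Qed.

Lemma order_simplexP v : v \in order_simplex -> exists i, order_vertex i = v.
Proof. by move=> /imfsetP[i _ ->]; exists i. Qed.

Lemma card_order_simplex : #|` order_simplex| = d.+1.
Proof.
rewrite card_imfset; last exact: order_vertex_inj.
by rewrite -[RHS]card_ord cardE.
Qed.

Lemma sum_order_simplex (V : nmodType) (F : 'rV[R]_d -> V) :
  \sum_(v <- order_simplex) F v = \sum_i F (order_vertex i).
Proof.
apply: (sum_vertices order_vertex_inj order_simplexP) => i.
by rewrite mem_order_vertex.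
Qed.

Lemma sum_order_vertex (t : 'I_d.+1 -> R) (j : 'I_d) :
  (\sum_i t i *: order_vertex i) ord0 j = \sum_(i : 'I_d.+1 | (i <= j)%N) t i.
Proof.
rewrite summxE [RHS]big_mkcond/=; apply: eq_bigr => i _; rewrite !mxE.
by case: leqP; rewrite ?mulr1 ?mulr0.
Qed.

Lemma is_simplex_order_simplex : is_simplex order_simplex.
Proof.
split; first by rewrite -cardfs_gt0 card_order_simplex.
move=> t; rewrite !sum_order_simplex => t0 tv.
(* For [k < d] this is coordinate [k] of the vanishing combination; for [k = d] it is the vanishing
   sum of all weights. *)
have partial k : (k <= d)%N ->
    \sum_(i : 'I_d.+1 | (i <= k)%N) t (order_vertex i) = 0.
  rewrite leq_eqVlt => /predU1P[->|kd].
    by rewrite -[RHS]t0; apply: eq_bigl => i; rewrite -ltnS ltn_ord.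
  by have /rowP/(_ (Ordinal kd)) := tv; rewrite sum_order_vertex mxE.
(* Strong induction on the index: a vanishing partial sum whose earlier terms vanish has a vanishing
   last term. *)
suff ti k (i : 'I_d.+1) : (i <= k)%N -> t (order_vertex i) = 0.
  by move=> v /order_simplexP[i <-]; exact: (ti d i (leq_ord i)).
elim: k i => [|k IH] i.
  rewrite leqn0 => /eqP i0; rewrite -[RHS](partial 0%N)// (bigD1 i) ?i0//=.
  rewrite big1 ?addr0// => j /andP[]; rewrite leqn0 => /eqP j0.
  by rewrite -val_eqE/= i0 j0.
rewrite leq_eqVlt => /predU1P[ik|]; last exact: IH.
rewrite -[RHS](partial k.+1); last by rewrite -ik leq_ord.
rewrite (bigD1 i) ?ik//= big1 ?addr0// => j /andP[jk ji].
by apply: IH; rewrite -ltnS ltn_neqAle jk andbT -ik.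
Qed.

(** Positive weights with sum 1 correspond to proper partial sums that increase strictly between 0
    and 1; the weights are recovered as consecutive differences. *)
Lemma open_order_simplexE : open_simplex order_simplex =
  [set x : 'rV[R]_d | (forall j, 0 < x ord0 j /\ x ord0 j < 1) /\
    forall j k : 'I_d, (j < k)%N -> x ord0 j < x ord0 k].
Proof.
apply/seteqP; split=> x.
  move=> [t [tp]]; rewrite !sum_order_simplex => t1 xt.
  have {}tp i : 0 < t (order_vertex i) by exact: tp (mem_order_vertex i).
  have sum_gt0 (P : pred 'I_d.+1) i : P i ->
      0 < \sum_(k | P k) t (order_vertex k).
    move=> Pi; rewrite (bigD1 i)//= ltr_pwDl//.
    by apply: sumr_ge0 => k _; exact: ltW.
  have xE j : x ord0 j = \sum_(i : 'I_d.+1 | (i <= j)%N) t (order_vertex i).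
    by rewrite xt sum_order_vertex.
  split=> [j|j k jk]; last first.
    rewrite !xE [ltRHS](bigID (fun i : 'I_d.+1 => i <= j)%N)/=.
    rewrite [X in _ < X + _](eq_bigl (fun i : 'I_d.+1 => i <= j)%N); last first.
      by move=> i /=; apply: andb_idl => /leq_trans; apply; exact: ltnW.
    (* The positive weight at [k] is counted in the sum up to [k] but not in the sum up to [j]. *)
    rewrite ltrDl (sum_gt0 _ (widen_ord (leqnSn d) k))//=.
    by rewrite leqnn -ltnNge jk.
  rewrite !xE; split; first exact: (sum_gt0 _ ord0).
  rewrite -t1 [ltRHS](bigID (fun i : 'I_d.+1 => i <= j)%N)/=.
  rewrite ltrDl (sum_gt0 _ ord_max)//=.
  by rewrite -ltnNge ltn_ord.
move=> [x01 xlt].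
(* The sequence 0, x_0, ..., x_(d-1), 1, with indices shifted by one: [insub] fails at [k' = d],
   which gives the final 1. *)
pose X k := if k is k'.+1 then
  (if insub k' is Some j then x ord0 j else 1) else 0.
have XS (j : 'I_d) : X j.+1 = x ord0 j by rewrite /X valK.
have Xd : X d.+1 = 1 by rewrite /X insubF// ltnn.
have Xsum k : (k <= d.+1)%N ->
    \sum_(i : 'I_d.+1 | (i < k)%N) (X i.+1 - X i) = X k.
  move=> kd; rewrite -(big_ord_widen _ (fun i => X i.+1 - X i) kd).
  by rewrite -(big_mkord predT (fun i => X i.+1 - X i)) telescope_sumr// subr0.
have Xlt (i : 'I_d.+1) : X i < X i.+1.
  case: i => -[|i] id.
    change (X 0%N < X 1%N).
    have [d0|d0] := posnP d.
      by rewrite /= insubF ?d0 ?ltr01.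
    by rewrite [ltRHS](XS (Ordinal d0)); have [] := x01 (Ordinal d0).
  change (X i.+1 < X i.+2); have id' : (i < d)%N by rewrite -ltnS.
  rewrite [ltLHS](XS (Ordinal id')).
  have [id1|id1] := ltnP i.+1 d.
    by rewrite [ltRHS](XS (Ordinal id1)); exact: xlt.
  by rewrite /= insubF ?ltnNge ?id1//; have [] := x01 (Ordinal id').
pose t v := if [pick i | order_vertex i == v] is Some i
            then X i.+1 - X i else 0.
have tE i : t (order_vertex i) = X i.+1 - X i.
  rewrite /t; case: pickP => [j /eqP/order_vertex_inj -> //|/(_ i)].
  by rewrite eqxx.
exists t; split.
- by move=> v /order_simplexP[i <-]; rewrite tE subr_gt0.
- rewrite sum_order_simplex -[RHS]Xd -Xsum//.
  by under eq_bigr do rewrite tE; apply: eq_bigl => i; rewrite ltn_ord.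
- rewrite sum_order_simplex; apply/rowP => j; rewrite sum_order_vertex.
  rewrite -XS -(Xsum j.+1); last by rewrite ltnS ltnW.
  by apply: eq_bigr => i _; rewrite tE.
Qed.

Lemma definable_order_simplex (S : ominimal_structure R) :
  definable S (open_simplex order_simplex).
Proof.
rewrite open_order_simplexE; apply: definable_setI.
  apply: definable_forall => j; apply: definable_setI.
    exact: definable_coord_gt.
  exact: definable_coord_lt.
apply: definable_forall => j; apply: definable_forall => k.
have [jk|kj] := boolP (j < k)%N.
  have := definable_lt_coords S j k; congr (definable S _).
  by apply/seteqP; split=> x //=; exact.
by have := definable_setT S d; congr (definable S _); apply/seteqP; split.
Qed.

End OrderSimplex.

Lemma generalized_complex1 (R : realType) (p : nat) (s : {fset 'rV[R]_p}) :
  is_simplex s -> generalized_complex [fset s]%fset.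
Proof.
move=> ss; split=> [t|t t']; rewrite !inE => /eqP ->//.
move=> /eqP ->; right; exists s; rewrite setIid; split=> //.
by case: ss.
Qed.

Lemma polyhedron1 (R : realType) (p : nat) (s : {fset 'rV[R]_p}) :
  polyhedron [fset s]%fset = open_simplex s.
Proof.
apply/seteqP; split=> x; first by move=> [t]; rewrite /= inE => /eqP ->.
by exists s => //=; rewrite inE.
Qed.

(** The range of the index in [euler_complex] survives as a filter, so no bound on the dimension of
    simplices has to be proved here. *)
Lemma euler_complexE (R : realType) (p : nat) (K : {fset {fset 'rV[R]_p}}) :
  euler_complex K = \sum_(s <- K | (simplex_dim s < p.+1)%N) euler_simplex s.
Proof.
rewrite /euler_complex [RHS]big_mkcond/=.
have cardE i : (#|` [fset s in K | simplex_dim s == i]%fset|)%:Z =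
    \sum_(s <- K) (simplex_dim s == i)%:R.
  rewrite card_fset_sum1 -big_fset_condE/= big_mkcond/=.
  rewrite -[LHS]natz raddf_sum; apply: eq_bigr => s _.
  by case: (_ == _).
under eq_bigr do rewrite cardE mulr_sumr.
rewrite exchange_big/=; apply: eq_bigr => s _.
case: ifPn => [sp|sp].
  rewrite (bigD1 (Ordinal sp))//= eqxx mulr1 big1 ?addr0// => i.
  by rewrite -val_eqE/= eq_sym => /negbTE ->; rewrite mulr0.
rewrite big1// => i _; rewrite (_ : _ == _ = false) ?mulr0//.
by apply/negbTE; apply: contra sp => /eqP ->.
Qed.

Lemma definable_map_id (R : realType) (S : ominimal_structure R) (n : nat)
    (A : set 'rV[R]_n) : definable S A -> definable_map S (@id A).
Proof.
move=> dA; split=> //.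
have := definable_setI (definable_prod dA (definable_setT S n))
  (definable_forall (fun j => definable_eq_coord S (lshift n j) (rshift n j))).
congr (definable S _); apply/seteqP; split=> z /=.
  move=> [[Az _] zE]; exists (to_set Az) => //=.
  rewrite -[RHS]hsubmxK; congr row_mx; apply/rowP => j.
  by rewrite !mxE zE.
move=> [x _ <-]; rewrite row_mxKl; split.
  by split=> //; exact: set_val_in.
by move=> j; rewrite row_mxEl row_mxEr.
Qed.

Lemma homeomorphism_id (T : topologicalType) : homeomorphism (@id T).
Proof.
have cid : continuous (@id T) by move=> x; exact: cvg_id.
by split=> //; exists id; split.
Qed.

Lemma euler_characteristic_order_simplex (R : realType)
    (S : ominimal_structure R) (d : nat) :
  has_euler_characteristic S (open_simplex (order_simplex R d)) ((-1) ^+ d).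
Proof.
rewrite -polyhedron1; exists d, [fset order_simplex R d]%fset, id; split.
  split.
    split; last exact: homeomorphism_id.
    exact/generalized_complex1/is_simplex_order_simplex.
  apply: definable_map_id; rewrite polyhedron1.
  exact: definable_order_simplex.
rewrite euler_complexE big_mkcond/= big_seq_fset1.
by rewrite /euler_simplex /simplex_dim card_order_simplex ltnSn.
Qed.

(** * Topological invariance of the characteristic of a polyhedron *)

Lemma cube_model1 (R : realType) (N p : nat) (w : 'I_N -> 'rV[R]_p) s :
  cube_model w [fset s]%fset = cube_face [set i | w i \in s]%SET.
Proof.
apply/seteqP; split=> x; first by move=> [t]; rewrite /= inE => /eqP ->.
by exists s => //=; rewrite inE.
Qed.

Lemma homeomorphic_cube_face (R : realType) (N p : nat)
    (w : 'I_N -> 'rV[R]_p) s :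
  is_simplex s -> injective w -> (forall v, v \in s -> exists i, w i = v) ->
  homeomorphic (@cube_face R N [set i | w i \in s]%SET) (open_simplex s).
Proof.
move=> ss w_inj ws; rewrite -cube_model1 -polyhedron1.
apply: homeomorphic_cube_model => //; first exact: generalized_complex1.
by move=> t v; rewrite inE => /eqP ->; exact: ws.
Qed.

(** Enumerating the vertices of either simplex turns it into the face of the cube with all
    coordinates positive, which depends only on the number of vertices. *)
Lemma homeomorphic_simplex (R : realType) (p q : nat)
    (s : {fset 'rV[R]_p}) (t : {fset 'rV[R]_q}) :
  is_simplex s -> is_simplex t -> #|` s| = #|` t| ->
  homeomorphic (open_simplex s) (open_simplex t).
Proof.
move=> ss st; have [w [w_inj ws w_surj]] := fset_enumeration s 0.
have [w' [w'_inj wt w'_surj]] := fset_enumeration t 0.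
have hs := homeomorphic_cube_face ss w_inj w_surj.
have ht := homeomorphic_cube_face st w'_inj w'_surj.
have Es : [set i | w i \in s]%SET = [set: _]%SET.
  by apply/setP => i; rewrite !inE ws.
have Et : [set i | w' i \in t]%SET = [set: _]%SET.
  by apply/setP => i; rewrite !inE wt.
rewrite Es in hs; rewrite Et in ht.
move=> E; rewrite -E in ht.
exact: homeomorphic_trans (homeomorphic_sym hs) ht.
Qed.

(** The graph of the restriction is the part of the graph of [phi] with values in [B], so it is
    definable because [B] is. *)
Lemma has_euler_characteristic_restrict (R : realType)
    (S : ominimal_structure R) (n p : nat) (A B : set 'rV[R]_n)
    (K L : {fset {fset 'rV[R]_p}}) (phi : polyhedron K -> A) :
  definable_triangulation S phi -> (L `<=` K)%fset ->
  definable S B -> B `<=` A ->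
  [set x : A | B (set_val x)] = \bigcup_(s in [set` L]) simplex_image phi s ->
  has_euler_characteristic S B (euler_complex L).
Proof.
move=> [[Kc hphi] [_ _ dG]] LK dB BA BE.
have LKp : polyhedron L `<=` polyhedron K.
  by move=> x [s sL sx]; exists s => //; exact: (fsubsetP LK).
have LB (x : polyhedron K) : polyhedron L (set_val x) <-> B (set_val (phi x)).
  change (polyhedron L (set_val x) <-> [set x : A | B (set_val x)] (phi x)).
  rewrite BE; split=> [[s sL sx]|[s sL [y sy]]].
    by exists s => //; exists x.
  have [_ [g [_ phiK _]]] := hphi.
  by move=> /(can_inj phiK) <-; exists s.
have [phi' [hphi' phi'E]] := homeomorphism_restrict hphi LKp BA LB.
have dG' : definable S (range (fun x : polyhedron L =>
    row_mx (set_val x) (set_val (phi' x)))).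
  have := definable_setI dG (definable_prod (definable_setT S p) dB).
  congr (definable S _); apply/seteqP; split=> z.
    move=> [[x _ <-]] /=; rewrite row_mxKr => -[_ /LB xL].
    by exists (to_set xL) => //=; rewrite (phi'E _ x).
  move=> [x _ <-]; have xK := LKp _ (set_val_in x).
  rewrite (phi'E x (to_set xK))//; split; first by exists (to_set xK).
  by rewrite /= row_mxKr; split=> //; apply/LB; exact: (set_val_in x).
exists p, L, phi'; split=> //; split; first split=> //.
  exact: generalized_complex_sub Kc.
(* The polyhedron of [L] is definable as the projection of this graph. *)
split=> //; have := definable_lsubmx dG'; congr (definable S _).
apply/seteqP; split=> x.
  by move=> [_ [y _ <-] <-]; rewrite row_mxKl; exact: set_val_in.
move=> Lx; exists (row_mx x (set_val (phi' (to_set Lx)))); last first.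
  by rewrite row_mxKl.
by exists (to_set Lx).
Qed.

Lemma sum_fset_partition (T : choiceType) (V : nmodType) (N : nat)
    (K : {fset T}) (L : 'I_N -> {fset T}) (F : T -> V) :
  (forall i, (L i `<=` K)%fset) ->
  (forall s, s \in K -> exists i, s \in L i) ->
  (forall i j s, s \in L i -> s \in L j -> i = j) ->
  \sum_(s <- K) F s = \sum_i \sum_(s <- L i) F s.
Proof.
move=> LK KL Ldisj.
have LE i : \sum_(s <- L i) F s = \sum_(s <- K) if s \in L i then F s else 0.
  have {1}-> : L i = [fset s in K | s \in L i]%fset.
    apply/fsetP => s; rewrite !inE/= andbC; case: (boolP (s \in L i)) => //= sL.
    by rewrite (fsubsetP (LK i)).
  by rewrite -big_fset_condE big_mkcond.
under [RHS]eq_bigr do rewrite LE.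
rewrite exchange_big/=; apply: eq_big_seq => s /KL[i si].
rewrite (bigD1 i)//= si big1 ?addr0// => j ji; case: ifPn => // sj.
by rewrite (Ldisj _ _ _ sj si) eqxx in ji.
Qed.

Section EulerCharacteristic.
Context (R : realType) (S : ominimal_structure R).
Hypothesis triangulation_thm : definable_triangulation_theorem S.
Hypothesis beke_thm : beke_theorem S.

(** By Beke's theorem the face has the characteristic of the order simplex of the same dimension, to
    which it is homeomorphic. *)
Lemma euler_characteristic_cube_face (N p : nat) (w : 'I_N -> 'rV[R]_p) s e :
  is_simplex s -> injective w -> (forall v, v \in s -> exists i, w i = v) ->
  has_euler_characteristic S (@cube_face R N [set i | w i \in s]%SET) e ->
  e = euler_simplex s.
Proof.
move=> ss w_inj ws he; pose d := simplex_dim s.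
apply: (beke_thm _ _ _ he (euler_characteristic_order_simplex S d)).
- exact: definable_cube_face.
- exact: definable_order_simplex.
- apply: homeomorphic_trans (homeomorphic_cube_face ss w_inj ws) _.
  apply: homeomorphic_simplex => //; first exact: is_simplex_order_simplex.
  rewrite card_order_simplex /d /simplex_dim prednK//.
  by case: ss; rewrite cardfs_gt0.
Qed.

(** Additivity: a triangulation of the model compatible with all its faces splits into
    triangulations of the faces, whose characteristics are known. *)
Lemma euler_characteristic_cube_model (N p : nat) (w : 'I_N -> 'rV[R]_p)
    (L : {fset {fset 'rV[R]_p}}) :
  generalized_complex L -> injective w ->
  (forall s v, s \in L -> v \in s -> exists i, w i = v) ->
  has_euler_characteristic S (cube_model w L) (\sum_(s <- L) euler_simplex s).
Proof.
move=> Lc w_inj wL.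
pose sg (i : 'I_#|` L|) := nth fset0 L i.
have sgL i : sg i \in L by rewrite /sg mem_nth.
have sg_inj : injective sg.
  by move=> i j /eqP; rewrite nth_uniq ?fset_uniq// => /eqP/val_inj.
pose F i := @cube_face R N [set j | w j \in sg i]%SET.
have dF i : definable S (F i) /\ F i `<=` cube_model w L.
  split; first exact: definable_cube_face.
  by move=> x Fx; exists (sg i) => //=; exact: sgL.
have [q [K [phi [phiT /choice[M MK]]]]] :=
  triangulation_thm (definable_cube_model S w L) dF.
exists q, K, phi; split=> //.
have [[Kc hphi] _] := phiT.
have [_ [g [_ phiK gK]]] := hphi.
rewrite euler_complexE [RHS]big_mkcond/= [RHS](sum_fset_partition (L := M)).
- rewrite (big_nth fset0) big_mkord; apply: eq_bigr => i _; rewrite -/(sg i).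
  have [MiK MiE] := MK i.
  have := has_euler_characteristic_restrict phiT MiK (dF i).1 (dF i).2 MiE.
  rewrite euler_complexE.
  have [Ls _] := Lc.
  have ws := wL _ ^~ (sgL i).
  move=> /(euler_characteristic_cube_face (Ls _ (sgL i)) w_inj ws) <-.
  by rewrite big_mkcond.
- by move=> i; case: (MK i).
(* A point of the simplex is sent into some face; by compatibility and disjointness, the simplex
   itself is listed for that face. *)
- move=> s sK; have [Ks _] := Kc; have [s0 _] := Ks _ sK.
  have [x sx] := open_simplex_nonempty s0.
  have Kx : polyhedron K x by exists s.
  have [t tL phix] := set_val_in (phi (to_set Kx)).
  have ti : (index t L < #|` L|)%N by rewrite index_mem.
  exists (Ordinal ti).
  have [MiK MiE] := MK (Ordinal ti).
  have : [set x : cube_model w L | F (Ordinal ti) (set_val x)]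
      (phi (to_set Kx)).
    by rewrite /= /F /sg /= nth_index.
  rewrite MiE => -[s' s'M [y s'y /(can_inj phiK) yx]].
  rewrite yx in s'y; rewrite (open_simplex_disjoint Kc sK _ sx s'y)//.
  exact: (fsubsetP MiK).
(* A simplex listed for two faces yields a point in both, and the positive coordinates of that point
   determine the face. *)
- move=> i j s si sj.
  have [MiK MiE] := MK i; have [MjK MjE] := MK j.
  have sK := fsubsetP MiK _ si.
  have [Ks _] := Kc; have [s0 _] := Ks _ sK.
  have [x sx] := open_simplex_nonempty s0.
  have Kx : polyhedron K x by exists s.
  have : [set x : cube_model w L | F i (set_val x)] (phi (to_set Kx)).
    by rewrite MiE; exists s => //; exists (to_set Kx).
  have : [set x : cube_model w L | F j (set_val x)] (phi (to_set Kx)).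
    by rewrite MjE; exists s => //; exists (to_set Kx).
  move=> [_ Fj] [_ Fi]; apply: sg_inj; apply/fsetP => v.
  apply/idP/idP => vs.
    have [k kv] := wL _ _ (sgL i) vs.
    have [_] := Fi k; have [_] := Fj k; rewrite !inE kv vs.
    by case: (v \in sg j) => // ->; rewrite ltxx.
  have [k kv] := wL _ _ (sgL j) vs.
  have [_] := Fi k; have [_] := Fj k; rewrite !inE kv vs.
  by case: (v \in sg i) => // + E; rewrite E ltxx.
Qed.

(* The o-minimal structure need not define any polyhedron, so Beke's theorem is
   applied to the cube models instead. *)
Lemma sum_euler_simplex_homeomorphic (p q : nat)
    (K : {fset {fset 'rV[R]_p}}) (L : {fset {fset 'rV[R]_q}}) :
  generalized_complex K -> generalized_complex L ->
  homeomorphic (polyhedron K) (polyhedron L) ->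
  \sum_(s <- K) euler_simplex s = \sum_(s <- L) euler_simplex s.
Proof.
move=> Kc Lc KL.
(* All vertices of a complex are enumerated together, as the cube model requires. *)
have vertices r (M : {fset {fset 'rV[R]_r}}) : exists N (w : 'I_N -> 'rV[R]_r),
    injective w /\ forall s v, s \in M -> v \in s -> exists i, w i = v.
  have [w [w_inj _ w_surj]] := fset_enumeration (\bigcup_(s <- M) s)%fset 0.
  exists _, w; split=> // s v sM vs; apply: w_surj.
  by apply/bigfcupP; exists s; rewrite ?sM.
have [N [w [w_inj wK]]] := vertices _ K.
have [N' [w' [w'_inj w'L]]] := vertices _ L.
apply: (beke_thm _ _ _ (euler_characteristic_cube_model Kc w_inj wK)
  (euler_characteristic_cube_model Lc w'_inj w'L)).
- exact: definable_cube_model.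
- exact: definable_cube_model.
- apply: homeomorphic_trans (homeomorphic_cube_model Kc w_inj wK) _.
  apply: homeomorphic_trans KL _; apply: homeomorphic_sym.
  exact: homeomorphic_cube_model.
Qed.

End EulerCharacteristic.

(** * The Euler integral *)

(** The images of distinct simplices are disjoint, so only the term of [s] survives at [phi x]. *)
Lemma simplex_image_sum (R : realType) (p : nat) (K : {fset {fset 'rV[R]_p}})
    (X : topologicalType) (phi : polyhedron K -> X)
    (c : {fset 'rV[R]_p} -> int) s (x : polyhedron K) :
  triangulation phi -> s \in K -> open_simplex s (set_val x) ->
  \sum_(t <- K) c t * \1_(simplex_image phi t) (phi x) = c s.
Proof.
move=> [Kc [_ [g [_ phiK _]]]] sK sx.
rewrite (bigD1_seq s)//= ?fset_uniq// indicE mem_set ?mulr1; last by exists x.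
rewrite big1_seq ?addr0// => t /andP[ts tK].
rewrite indicE memNset ?mulr0// => -[y ty /(can_inj phiK) yx].
by rewrite yx in ty; rewrite (open_simplex_disjoint Kc sK tK sx ty) eqxx in ts.
Qed.

(** [V] is any list containing the values of [c], which lets two complexes be sorted by one common
    list. *)
Lemma sum_level_sets (T : choiceType) (K : {fset T}) (V : seq int)
    (c F : T -> int) :
  uniq V -> (forall s, s \in K -> c s \in V) ->
  \sum_(s <- K) c s * F s =
  \sum_(v <- V) v * \sum_(s <- [fset s in K | c s == v]%fset) F s.
Proof.
move=> Vu cV; under [RHS]eq_bigr do
  rewrite -big_fset_condE big_mkcond/= mulr_sumr.
rewrite exchange_big/=; apply: eq_big_seq => s /cV cs.
rewrite (bigD1_seq (c s))//= eqxx big1 ?addr0// => v vc.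
by rewrite eq_sym (negbTE vc) mulr0.
Qed.

(** Sorted by the coefficient [v], the two sums agree term by term: in both triangulations the
    simplices with coefficient [v] fill the level set of [h] at [v], so their unions are
    homeomorphic. *)
Lemma euler_integral_unique (R : realType) (S : ominimal_structure R)
    (X : topologicalType) (h : X -> int) z z' :
  definable_triangulation_theorem S -> beke_theorem S ->
  is_euler_integral R h z -> is_euler_integral R h z' -> z = z'.
Proof.
move=> tri beke [p [K [phi [c [phiT hc ->]]]]] [q [L [psi [b [psiT hb ->]]]]].
have [Kc hphi] := phiT; have [Lc hpsi] := psiT.
pose V := undup ([seq c s | s <- K] ++ [seq b s | s <- L]).
rewrite (sum_level_sets (V := V)) ?undup_uniq//; last first.
  by move=> s sK; rewrite mem_undup mem_cat map_f.
rewrite [RHS](sum_level_sets (V := V)) ?undup_uniq//; last first.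
  by move=> s sL; rewrite mem_undup mem_cat (map_f b) ?orbT.
apply: eq_bigr => v _; congr (v * _).
set Kv := [fset s in K | _]%fset; set Lv := [fset s in L | _]%fset.
have KvK : (Kv `<=` K)%fset by exact: fset_sub.
have LvL : (Lv `<=` L)%fset by exact: fset_sub.
apply: (sum_euler_simplex_homeomorphic tri beke).
- exact: generalized_complex_sub KvK Kc.
- exact: generalized_complex_sub LvL Lc.
have [cpsi [g [cg psiK gK]]] := hpsi.
have hg : homeomorphism g by split=> //; exists psi.
have [||x|f [hf _]] := homeomorphism_restrict (A' := polyhedron Kv)
    (B' := polyhedron Lv) (homeomorphism_comp hphi hg).
- by move=> x [s sK sx]; exists s => //; exact: (fsubsetP KvK).
- by move=> x [s sL sx]; exists s => //; exact: (fsubsetP LvL).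
- have Kvx : polyhedron Kv (set_val x) <-> h (phi x) = v.
    split=> [[s]|hv].
      rewrite /= !inE/= => /andP[sK /eqP <-] sx.
      by rewrite hc (simplex_image_sum c phiT sK sx).
    have [s sK sx] := set_val_in x; exists s => //=.
    by rewrite !inE/= [s \in K]sK/= -hv hc (simplex_image_sum c phiT sK sx).
  have Lvx y : polyhedron Lv (set_val y) <-> h (psi y) = v.
    split=> [[s]|hv].
      rewrite /= !inE/= => /andP[sK /eqP <-] sx.
      by rewrite hb (simplex_image_sum b psiT sK sx).
    have [s sK sx] := set_val_in y; exists s => //=.
    by rewrite !inE/= [s \in L]sK/= -hv hb (simplex_image_sum b psiT sK sx).
  by rewrite Kvx Lvx /= gK.
by exists f.
Qed.

(** A triangulation of [A] compatible with the images of all level sets is carried to [X] by the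
    inverse of [beta]; each [h i] is then constant on every open simplex. *)
Lemma common_triangulation (R : realType) (S : ominimal_structure R)
    (n : nat) (A : set 'rV[R]_n) (X : topologicalType) (beta : X -> A)
    (m : nat) (h : 'I_m -> X -> int) :
  definable_triangulation_theorem S -> definable S A ->
  homeomorphism beta -> (forall i, HCF S beta (h i)) ->
  exists p (K : {fset {fset 'rV[R]_p}}) (phi : polyhedron K -> X)
      (c : 'I_m -> {fset 'rV[R]_p} -> int),
    triangulation phi /\ forall i x,
      h i x = \sum_(s <- K) c i s * \1_(simplex_image phi s) x.
Proof.
move=> tri dA [cbeta [g [cg betaK gK]]] hH.
have /choice[M hM] : forall i, exists M : int, forall x, `|h i x| <= M.
  by move=> i; have [] := hH i.
(* A common bound, so that only finitely many levels have to be listed. *)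
pose B := (\sum_i `|M i|)%N.
have hB i x : (`|h i x| <= B)%N.
  rewrite (@leq_trans `|M i|%N)//.
    by have := hM i x; lia.
  by rewrite /B (bigD1 i)//= leq_addr.
(* A second component [k] stands for the value [k - B], so the [B + B + 1] ordinals cover all values
   from [-B] to [B]. *)
pose I := ('I_m * 'I_(B + B).+1)%type.
pose level (k : I) : set X := [set x | h k.1 x = k.2%:Z - B%:Z].
pose F (j : 'I_#|{: I}|) := [set set_val (beta x) | x in level (enum_val j)].
have dF j : definable S (F j) /\ F j `<=` A.
  split; first by have [_ _] := hH (enum_val j).1; exact.
  by move=> _ [x _ <-]; exact: set_val_in.
have [p [K [phi [[[Kc hphi] _] phiF]]]] := tri n A _ F dA dF.
have [_ [phi' [_ phiK _]]] := hphi.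
have hg : homeomorphism g by split=> //; exists beta.
have gphiT : triangulation (g \o phi).
  by split=> //; exact: homeomorphism_comp.
(* The coefficient is the constant value of [h i] on the simplex; sets outside [K] get the default
   0. *)
have /choice[c hc] : forall k : 'I_m * {fset 'rV[R]_p}, exists c : int,
    k.2 \in K -> forall x, open_simplex k.2 (set_val x) ->
    h k.1 (g (phi x)) = c.
  move=> [i s] /=; have [sK|_] := boolP (s \in K); last by exists 0.
  have [Ks _] := Kc; have [s0 _] := Ks _ sK.
  have [x0 sx0] := open_simplex_nonempty s0.
  have Kx0 : polyhedron K x0 by exists s.
  exists (h i (g (phi (to_set Kx0)))) => _ x sx.
  set v := h i (g (phi (to_set Kx0))).
  have kB : (`|(v + B%:Z)%R| < (B + B).+1)%N.
    by have := hB i (g (phi (to_set Kx0))); rewrite -/v; lia.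
  pose j : 'I_#|{: I}| := enum_rank (i, Ordinal kB).
  have kE : (`|(v + B%:Z)%R|%N)%:Z - B%:Z = v.
    by have := hB i (g (phi (to_set Kx0))); rewrite -/v; lia.
  have Fj y : F j (set_val y) <-> h i (g y) = v.
    split=> [[x' + /set_val_inj <-]|hy].
      by rewrite /level /= enum_rankK/= kE betaK.
    by exists (g y); rewrite ?gK// /level /= enum_rankK/= kE.
  apply/Fj; have [L [LK LE]] := phiF j.
  have LF y :
      F j (set_val y) <-> (\bigcup_(t in [set` L]) simplex_image phi t) y.
    by rewrite -LE.
  (* The sample point [x0] lies in some simplex of [L], which by disjointness is [s]; so all of [s]
     maps into the level set. *)
  have /LF[t tL [y ty /(can_inj phiK) yx]] : F j (set_val (phi (to_set Kx0))).
    exact/Fj.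
  rewrite yx in ty.
  have st := open_simplex_disjoint Kc sK (fsubsetP LK _ tL) sx0 ty; subst t.
  by apply/LF; exists s => //; exists x.
exists p, K, (g \o phi), (fun i s => c (i, s)); split=> // i x.
have [_ [gphi' [_ _ gphiK]]] := gphiT.2.
have [s sK sx] := set_val_in (gphi' x).
by rewrite -(gphiK x) (simplex_image_sum _ gphiT sK sx) (hc (i, s) sK _ sx).
Qed.

Theorem theorem3p4 (R : realType) (S : ominimal_structure R)
    (triangulation_thm : definable_triangulation_theorem S)
    (beke_thm : beke_theorem S)
    (n : nat) (A : set 'rV[R]_n) (definable_A : definable S A)
    (X : topologicalType) (beta : X -> A) (homeo_beta : homeomorphism beta)
    (m : nat) (h : 'I_m -> X -> int) (h_HCF : forall i, HCF S beta (h i)) :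
  euler_integral R (fun x : X => \sum_(i < m) h i x) =
  \sum_(i < m) euler_integral R (h i).
Proof.
(* By uniqueness the value chosen by [xget] is the one given by any known representation. *)
have integralE f z : is_euler_integral R f z -> euler_integral R f = z.
  move=> fz; apply: xget_unique => // z' fz'.
  exact: euler_integral_unique triangulation_thm beke_thm fz' fz.
have [p [K [phi [c [phiT hc]]]]] :=
  common_triangulation triangulation_thm definable_A homeo_beta h_HCF.
have hI i : euler_integral R (h i) = \sum_(s <- K) c i s * euler_simplex s.
  by apply: integralE; exists p, K, phi, (c i); split.
under [RHS]eq_bigr do rewrite hI.
rewrite exchange_big/=; apply: integralE.
(* The sum is represented over the same complex by adding the coefficients. *)
exists p, K, phi, (fun s => \sum_i c i s); split=> //.
  move=> x; under eq_bigr do rewrite hc.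
  by rewrite exchange_big/=; apply: eq_bigr => s _; rewrite mulr_suml.
by apply: eq_bigr => s _; rewrite mulr_suml.
Qed.
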